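(* Let $\theta\in(0,\pi)$ and consider the isosceles triangle shape with $m_3$ at the mid point between $m_1$ and $m_2$, given by $\theta=\theta_2-\theta_3=\theta_3-\theta_1$. For every $\theta\in(0,\pi)\setminus\{\pi/2\}$ this isosceles shape is a rigid rotator. Moreover, the corresponding relative equilibria satisfy: (i) $\theta_3\equiv 0 \pmod{\pi}$ if $\theta\in(0,2\pi/3)\setminus\{\pi/2\}$; (ii) $\theta_3\equiv \pi/2 \pmod{\pi}$ if $2\pi/3<\theta<\pi$; (iii) $\theta_3$ is arbitrary if $\theta=2\pi/3$ (i.e. for every value of $\theta_3$ there is a relative equilibrium with this shape).
   Context: Three bodies of equal mass $1$ lie on a rotating meridian (a great circle through the poles, rotating about the $z$-axis with constant angular velocity $\omega$) of the unit sphere $\mathbb{S}^2$, and interact through the cotangent potential. The position of body $k\in\{1,2,3\}$ (with mass denoted $m_k$) on the meridian is the signed angle $\theta_k$ (modulo $2\pi$) from the north pole; write $\theta_{ij}=\theta_i-\theta_j$. The equations of motion are defined only if no two bodies coincide or are antipodal, i.e. $\sin\theta_{ij}\ne 0$ for $i\neq j$. A configuration $(\theta_1,\theta_2,\theta_3)$ is a relative equilibrium on a rotating meridian with angular velocity $\omega\in\mathbb{R}$ (the value $\omega=0$, a fixed point, is allowed) if it satisfies the equations of motion $$\frac{\omega^2}{2}\sin(2\theta_k)=\sum_{i\ne k}\frac{\sin(\theta_k-\theta_i)}{|\sin(\theta_k-\theta_i)|^3},\qquad k=1,2,3.$$ A shape is the collection of mutual angles, determined by $(\theta_{21},\theta_{31})$.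 A shape is called a rigid rotator if there exist $\theta_1\in\mathbb{R}$ and $\omega\in\mathbb{R}$ such that $(\theta_1,\theta_1+\theta_{21},\theta_1+\theta_{31})$ is a relative equilibrium with angular velocity $\omega$; the relative equilibria obtained this way are the relative equilibria corresponding to the shape. For the isosceles shape with parameter $\theta$ the configuration is $(\theta_1,\theta_2,\theta_3)=(\theta_3-\theta,\theta_3+\theta,\theta_3)$. *)

(* Defs.v *)
From mathcomp Require Import all_boot all_order all_algebra.
From mathcomp Require Import all_classical all_reals all_analysis.

Set Implicit Arguments.
Unset Strict Implicit.
Unset Printing Implicit Defensive.

Import Order.TTheory GRing.Theory Num.Theory.

Local Open Scope ring_scope.

Definition eqmod (R : realType) (m x y : R) : Prop :=
  exists n : int, x - y = n%:~R * m.

(* Bodies are indexed from 0: [q i] is the angle theta_(i+1) from the north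
   pole.  Angles are real representatives of classes modulo 2 pi; every notion
   below is invariant under a change of representative. *)
Definition configuration (R : realType) := 'I_3 -> R.

Definition body1 : 'I_3 := @Ordinal 3 0 isT.
Definition body2 : 'I_3 := @Ordinal 3 1 isT.
Definition body3 : 'I_3 := @Ordinal 3 2 isT.

(* No two bodies coincide or are antipodal. *)
Definition nonsingular (R : realType) (q : configuration R) : Prop :=
  forall i j : 'I_3, i != j -> sin (q i - q j) != 0.

(* Unit masses and cotangent potential.  The equations only make sense for
   nonsingular configurations, while division is total, hence the first
   conjunct. *)
Definition relative_equilibrium (R : realType) (omega : R)
    (q : configuration R) : Prop :=
  nonsingular q /\
  forall k : 'I_3,
    omega ^+ 2 / 2 * sin (2 * q k) =
    \sum_(i < 3 | i != k) sin (q k - q i) / `|sin (q k - q i)| ^+ 3.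

(* theta_21 = theta_2 - theta_1 and theta_31 = theta_3 - theta_1. *)
Record triangle_shape (R : realType) := Shape { theta21 : R ; theta31 : R }.

Definition shape_configuration (R : realType) (s : triangle_shape R) (theta1 : R) :
    configuration R :=
  fun i => [:: theta1; theta1 + theta21 s; theta1 + theta31 s]`_i.

Definition rigid_rotator (R : realType) (s : triangle_shape R) : Prop :=
  exists theta1 omega : R,
    relative_equilibrium omega (shape_configuration s theta1).

(* theta = theta_2 - theta_3 = theta_3 - theta_1. *)
Definition isosceles (R : realType) (theta : R) : triangle_shape R :=
  Shape (2 * theta) theta.

Lemma isosceles_configurationE (R : realType) (theta theta3 : R) :
  shape_configuration (isosceles theta) (theta3 - theta) =
  fun i => [:: theta3 - theta; theta3 + theta; theta3]`_i.
Proof.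
apply/funext => i; rewrite /shape_configuration /=.
by rewrite mulr_natl mulr2n addrA subrK.
Qed.

(* Main.v *)
Require Import Defs.
From mathcomp Require Import all_boot all_order all_algebra.
From mathcomp Require Import all_classical all_reals all_analysis.
From mathcomp Require Import ring lra.

Set Implicit Arguments.
Unset Strict Implicit.
Unset Printing Implicit Defensive.

Import Order.TTheory GRing.Theory Num.Theory.

Local Open Scope ring_scope.

(** Write [W := omega ^+ 2 / 2] and [theta3 := theta1 + theta].  By symmetry the
    forces that the two outer bodies exert on the middle one cancel, and the
    outer bodies feel opposite forces.  The equation of the middle body is thus
    [W * sin (2 * theta3) = 0]; given it, the addition formulas turn the
    equations of both outer bodies into the single equation
    [W * cos (2 * theta3) = isosceles_coef theta], the right-hand side depending
    on the shape alone ([isosceles_equilibriumP]).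

    Everything follows from the sign of that right-hand side, which is the sign
    of [1 + 4 * (cos theta * `|cos theta|)]; on the open interval from 0 to [pi]
    it changes exactly where [cos theta = - 1 / 2], that is at
    [theta = 2 * pi / 3] ([isosceles_coef_sign]).  Since [W >= 0]:
    - a positive value forces [W > 0], so [sin (2 * theta3) = 0] and
      [cos (2 * theta3) > 0], which leaves [sin theta3 = 0]
      ([double_angle_pos]);
    - a negative value leaves [cos theta3 = 0] ([double_angle_neg]);
    - at the zero, [W = 0] solves both equations whatever [theta3] is.
    Conversely, [theta3 = 0] or [theta3 = pi / 2] with [W] the absolute value of
    the coefficient is a solution, so the shape is a rigid rotator as soon as it
    is nonsingular, that is for [theta != pi / 2]. *)

Lemma sin2M (R : realType) (x : R) : sin (2 * x) = 2 * (sin x * cos x).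
Proof. by rewrite mulr_natl sin_mulr2n mulr_natl [cos x * _]mulrC. Qed.

Lemma cos2M (R : realType) (x : R) : cos (2 * x) = cos x ^+ 2 - sin x ^+ 2.
Proof. by rewrite mulr_natl mulr2n cosD !expr2. Qed.

Lemma sinZpi (R : realType) (n : int) : sin (n%:~R * pi : R) = 0.
Proof.
suff sin_natpi (m : nat) : sin (m%:R * pi : R) = 0.
  case: n => m; first exact: sin_natpi.
  by rewrite NegzE mulrNz mulNr sinN sin_natpi oppr0.
by rewrite mulr_natl -[pi *+ m]add0r (alternatingn (@sinDpi R)) sin0 mulr0.
Qed.

(** Subtracting from [x] the right multiple of [pi] gives a zero of the sine in
    the half-open interval from 0 to [pi], and the sine is positive inside. *)
Lemma sin_eq0_eqmod (R : realType) (x : R) : sin x = 0 -> eqmod pi x 0.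
Proof.
move=> sx0; set n := Num.floor (x / pi); exists n; rewrite subr0.
have := floor_itv (x / pi); rewrite -/n intrD ler_pdivlMr ?pi_gt0//.
rewrite ltr_pdivrMr ?pi_gt0// mulrDl mul1r => /andP[].
rewrite le_eqVlt => /predU1P[-> //|n_lt] lt_n.
have : 0 < sin (x - n%:~R * pi).
  by apply: sin_gt0_pi; rewrite subr_gt0 n_lt/= ltrBlDl.
by rewrite sinB sx0 sinZpi mul0r mulr0 subr0 ltxx.
Qed.

Lemma cos_eq0_eqmod (R : realType) (x : R) : cos x = 0 -> eqmod pi x (pi / 2).
Proof.
move=> cx0; have [|n] := @sin_eq0_eqmod R (x - pi / 2).
  by rewrite sinBpihalf cx0 oppr0.
by rewrite subr0 => xE; exists n.
Qed.

(** For [u := 2 * pi / 3] one has [2 * u = 2 * pi - u], so [sin (2 * u)] is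
    [- sin u]; the duplication formula then gives [2 * cos u = - 1]. *)
Lemma cos_2pi3 (R : realType) : cos (2 * pi / 3 : R) = - (1 / 2).
Proof.
set u : R := 2 * pi / 3.
have su_gt0 : 0 < sin u.
  by apply: sin_gt0_pi; rewrite /u; have := pi_gt0 R; lra.
have : sin (2 * u) = - sin u.
  by rewrite -sinN -(sinD2pi (- u)) -mulr_natl; congr sin; rewrite /u; field.
rewrite sin2M => su2.
suff : sin u * (2 * cos u + 1) = 0.
  by move/eqP; rewrite mulf_eq0 gt_eqF//= => /eqP; lra.
by rewrite mulrDr mulr1 mulrCA su2 addNr.
Qed.

(** The value that equilibrium imposes on [omega ^+ 2 / 2 * cos (2 * theta3)],
    obtained as the net force on body 2 divided by [sin (2 * theta)].  In this
    closed form the denominator is positive for nonsingular shapes, so that the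
    numerator carries the sign. *)
Definition isosceles_coef (R : realType) (theta : R) : R :=
  (1 + 4 * (cos theta * `|cos theta|)) / `|sin (2 * theta)| ^+ 3.

Lemma bodyP (i : 'I_3) : [\/ i = body1, i = body2 | i = body3].
Proof. by case: i => [[|[|[|//]]] iP]; constructor; apply: val_inj. Qed.

Lemma sum_other_bodies (R : realType) (F : 'I_3 -> R) (k : 'I_3) :
  \sum_(i < 3 | i != k) F i =
    (if body1 != k then F body1 else 0) + (if body2 != k then F body2 else 0) +
    (if body3 != k then F body3 else 0).
Proof.
rewrite big_mkcond !big_ord_recl big_ord0 [RHS]/= -[in RHS]addrA.
rewrite -[X in _ = _ + (_ + X)]addr0.
by congr (_ + (_ + (_ + _)));
  congr (if ~~ (_ == _) then F _ else 0); apply: val_inj.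
Qed.

Lemma sin_isoscelesB (R : realType) (theta theta1 : R)
    (q := shape_configuration (isosceles theta) theta1) :
  ((sin (q body1 - q body2) = - sin (2 * theta)) *
   (sin (q body1 - q body3) = - sin theta) *
   (sin (q body2 - q body1) = sin (2 * theta)) *
   (sin (q body2 - q body3) = sin theta) *
   (sin (q body3 - q body1) = sin theta) *
   (sin (q body3 - q body2) = - sin theta))%type.
Proof.
by rewrite -!sinN /q /shape_configuration /=; do !split; congr sin; ring.
Qed.

(** The outer bodies are at distance [2 * theta] from each other and [theta] from
    the middle one, and [sin theta] divides [sin (2 * theta)]. *)
Lemma isosceles_nonsingularP (R : realType) (theta theta1 : R) :
  nonsingular (shape_configuration (isosceles theta) theta1) <->
  sin (2 * theta) != 0.
Proof.
have sinE := sin_isoscelesB theta theta1.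
split=> [/(_ body2 body1 isT)|s2]; first by rewrite sinE.
have s1 : sin theta != 0.
  by apply: contra_neq s2 => s0; rewrite sin2M s0 mul0r mulr0.
by move=> i j; case: (bodyP i) => ->; case: (bodyP j) => -> // _;
  rewrite sinE ?oppr_eq0.
Qed.

(** The left-hand side is the force on body 2 (and the opposite of the force on
    body 1).  In each sign pattern of [sin theta] and [cos theta], replacing
    [sin (2 * theta)] by [2 * (sin theta * cos theta)] makes both sides rational
    functions of the two. *)
Lemma isosceles_force (R : realType) (theta : R) :
  sin (2 * theta) != 0 ->
  sin (2 * theta) / `|sin (2 * theta)| ^+ 3 + sin theta / `|sin theta| ^+ 3 =
  isosceles_coef theta * sin (2 * theta).
Proof.
rewrite /isosceles_coef sin2M => s2.
have [s_neq0 c_neq0] : sin theta != 0 /\ cos theta != 0.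
  by move: s2; rewrite mulf_eq0 mulf_eq0 !negb_or => /and3P[].
rewrite !normrM [`|2|]ger0_norm//.
case: (ltrgt0P (sin theta)) (s_neq0) => // [s_gt0|s_lt0] _.
all: case: (ltrgt0P (cos theta)) (c_neq0) => // [c_gt0|c_lt0] _.
all: by field; rewrite c_neq0 s_neq0.
Qed.

(** With [t := 2 * (theta1 + theta)], the doubled angles of the bodies are
    [t - 2 * theta], [t + 2 * theta] and [t].  Body 3 gives [W * sin t = 0], and
    half the difference of the equations of bodies 2 and 1 gives
    [W * cos t * sin (2 * theta)] as the force on body 2. *)
Lemma isosceles_equilibriumP (R : realType) (theta theta1 omega : R) :
  relative_equilibrium omega (shape_configuration (isosceles theta) theta1) <->
  [/\ sin (2 * theta) != 0,
      omega ^+ 2 / 2 * sin (2 * (theta1 + theta)) = 0 &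
      omega ^+ 2 / 2 * cos (2 * (theta1 + theta)) = isosceles_coef theta].
Proof.
rewrite /relative_equilibrium isosceles_nonsingularP.
set q := shape_configuration _ _; set W := omega ^+ 2 / 2.
set t := 2 * (theta1 + theta).
have sinE := sin_isoscelesB theta theta1; rewrite -/q in sinE.
have q1 : 2 * q body1 = t - 2 * theta.
  by rewrite /q /t /shape_configuration /=; ring.
have q2 : 2 * q body2 = t + 2 * theta.
  by rewrite /q /t /shape_configuration /=; ring.
have q3 : 2 * q body3 = t by [].
split=> [[s2 eqm]|[s2 sint cost]]; have := isosceles_force s2.
  move: (eqm body1) (eqm body2) (eqm body3).
  rewrite !sum_other_bodies /= !sinE q1 q2 q3 sinB sinD !normrN.
  move=> e1 e2 e3 force; split=> //; first by rewrite e3; ring.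
  apply: (mulIf s2); rewrite -force; lra.
move=> force; split=> // k.
by case: (bodyP k) => ->;
  rewrite !sum_other_bodies /= !sinE ?q1 ?q2 ?q3 ?sinB ?sinD ?normrN
          ?mulrBr ?mulrDr ?mulrA ?sint ?cost ?mul0r; lra.
Qed.

(** The cosine decreases on the interval from 0 to [pi], hence [cos theta] exceeds
    [- 1 / 2] exactly when [theta < 2 * pi / 3]; and [1 + 4 * (c * `|c|)]
    increases in [c] and vanishes at [- 1 / 2]. *)
Lemma isosceles_coef_sign (R : realType) (theta : R) :
  0 < theta -> theta < pi -> sin (2 * theta) != 0 ->
  Num.sg (isosceles_coef theta) = Num.sg (2 * pi / 3 - theta).
Proof.
move=> theta_gt0 theta_ltpi s2; have pi0 := pi_gt0 R.
rewrite /isosceles_coef sgrM [X in _ * X]gtr0_sg ?mulr1; last first.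
  by rewrite invr_gt0 exprn_gt0 ?normr_gt0.
have thetaI : theta \in `[0, pi] by rewrite in_itv/= !ltW.
have uI : 2 * pi / 3 \in `[0, (pi : R)].
  by rewrite in_itv/=; apply/andP; split; lra.
have [theta_lt|theta_gt|theta_eq] := ltrgtP theta (2 * pi / 3).
- have := theta_lt; rewrite -ltr_cos// cos_2pi3 => c_gt.
  rewrite !gtr0_sg//; first by rewrite subr_gt0.
  by case: (ger0P (cos theta)) => c0; nra.
- have := theta_gt; rewrite -ltr_cos// cos_2pi3 => c_lt.
  rewrite !ltr0_sg//; first by rewrite subr_lt0.
  by case: (ger0P (cos theta)) => c0; nra.
- rewrite theta_eq subrr cos_2pi3 ler0_norm; last by lra.
  by congr Num.sg; field.
Qed.

Lemma sin2M_neq0 (R : realType) (theta : R) :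
  0 < theta -> theta < pi -> theta != pi / 2 -> sin (2 * theta) != 0.
Proof.
move=> theta_gt0 theta_ltpi; apply: contra_neq => s2; have pi0 := pi_gt0 R.
have s_gt0 : 0 < sin theta by apply: sin_gt0_pi; rewrite theta_gt0.
have c0 : cos theta = 0.
  by move/eqP: s2; rewrite sin2M !mulf_eq0 pnatr_eq0/= gt_eqF// => /eqP.
apply: cos_inj; last by rewrite c0 cos_pihalf.
  by rewrite in_itv/= !ltW.
by rewrite in_itv/=; apply/andP; split; lra.
Qed.

(** If [cos t] vanished, [cos (2 * t)] would be [- sin t ^+ 2 <= 0]. *)
Lemma double_angle_pos (R : realType) (W t : R) :
  0 <= W -> W * sin (2 * t) = 0 -> 0 < W * cos (2 * t) -> sin t = 0.
Proof.
rewrite le_eqVlt => /predU1P[<-|W_gt0]; first by rewrite !mul0r ltxx.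
rewrite pmulr_rgt0// cos2M sin2M => /eqP.
rewrite !mulf_eq0 gt_eqF//= pnatr_eq0/= => /orP[/eqP//|/eqP ->].
by rewrite expr0n/= sub0r oppr_gt0 ltNge sqr_ge0.
Qed.

(** The shift of [t] by [pi / 2] flips the signs of the sine and the cosine of
    the double angle, which reduces to the positive case. *)
Lemma double_angle_neg (R : realType) (W t : R) :
  0 <= W -> W * sin (2 * t) = 0 -> W * cos (2 * t) < 0 -> cos t = 0.
Proof.
move=> W_ge0 sint cost; rewrite -sinDpihalf; apply: (double_angle_pos W_ge0).
  by rewrite mulrDr mulrCA mulfV ?mulr1 ?pnatr_eq0// sinDpi mulrN sint oppr0.
by rewrite mulrDr mulrCA mulfV ?mulr1 ?pnatr_eq0// cosDpi mulrN oppr_gt0.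
Qed.

Theorem theorem2 (R : realType) (theta : R)
    (theta_gt0 : 0 < theta) (theta_ltpi : theta < pi) :
  [/\ theta != pi / 2 -> rigid_rotator (isosceles theta),
      theta < 2 * pi / 3 -> theta != pi / 2 ->
        forall theta1 omega : R,
          relative_equilibrium omega
            (shape_configuration (isosceles theta) theta1) ->
          eqmod pi (shape_configuration (isosceles theta) theta1 body3) 0,
      2 * pi / 3 < theta ->
        forall theta1 omega : R,
          relative_equilibrium omega
            (shape_configuration (isosceles theta) theta1) ->
          eqmod pi (shape_configuration (isosceles theta) theta1 body3) (pi / 2)
    & theta = 2 * pi / 3 ->
        forall theta3 : R, exists theta1 omega : R,
          relative_equilibrium omega
            (shape_configuration (isosceles theta) theta1) /\
          shape_configuration (isosceles theta) theta1 body3 = theta3 ].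
Proof.
have sgE := isosceles_coef_sign theta_gt0 theta_ltpi.
split.
- move=> /(sin2M_neq0 theta_gt0 theta_ltpi) s2.
  have half_sqrt (x : R) : 0 <= x -> Num.sqrt (2 * x) ^+ 2 / 2 = x.
    by move=> x0; rewrite sqr_sqrtr ?mulr_ge0// mulrAC mulfV ?mul1r.
  have [coef_ge0|coef_lt0] := lerP 0 (isosceles_coef theta).
    exists (- theta), (Num.sqrt (2 * isosceles_coef theta)).
    apply/isosceles_equilibriumP; rewrite addNr mulr0 sin0 cos0 mulr0 mulr1.
    by rewrite half_sqrt.
  exists (pi / 2 - theta), (Num.sqrt (2 * - isosceles_coef theta)).
  apply/isosceles_equilibriumP; rewrite subrK mulrCA mulfV// mulr1 sinpi cospi.
  by rewrite half_sqrt ?oppr_ge0 ?ltW// mulr0 mulrN1 opprK.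
- move=> theta_lt _ theta1 omega /isosceles_equilibriumP[s2 sint cost].
  apply: sin_eq0_eqmod; apply: double_angle_pos sint _.
    by rewrite divr_ge0// sqr_ge0.
  by rewrite cost -sgr_gt0 sgE// sgr_gt0 subr_gt0.
- move=> theta_gt theta1 omega /isosceles_equilibriumP[s2 sint cost].
  apply: cos_eq0_eqmod; apply: double_angle_neg sint _.
    by rewrite divr_ge0// sqr_ge0.
  by rewrite cost -sgr_lt0 sgE// sgr_lt0 subr_lt0.
- move=> theta_eq theta3; exists (theta3 - theta), 0; split; last exact: subrK.
  have s2 : sin (2 * theta) != 0.
    apply: sin2M_neq0 => //; have := pi_gt0 R; rewrite theta_eq => pi0.
    by apply/eqP; lra.
  apply/isosceles_equilibriumP; rewrite expr0n/= !mul0r; split=> //.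
  by apply/esym/eqP; rewrite -sgr_eq0 sgE// sgr_eq0 theta_eq subrr.
Qed.
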